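(* Suppose $\Theta$ is compact, $\theta\mapsto L_n(\theta;Y)$ is $\mathsf P$-almost surely continuous on $\Theta$ for every $n$, and that for every small enough $\varepsilon>0$ there are a finite number $s$ (not depending on $n$), subsets $A_i=A_i(\varepsilon)\subseteq\Theta$ and corresponding subcollections $W^{(i)}$ of $Y$ with $m_i=m_i(n)$ components, $i=1,\dots,s$, such that $\bigcup_{i=1}^s A_i\supseteq\Theta\cap B_\varepsilon(\theta^0)^c$ and the following three conditions hold. (1) Each $A_i$ is identified by $W^{(i)}$ with some identification rate $a_{n,i}$, $n=1,2,\dots$, $i=1,\dots,s$. (2) For every $i\in\{1,\dots,s\}$ and $n\in\{1,2,\dots\}$ there exists a random variable $K_{n,i}$ not depending on $\theta$ such that, $\mathsf{P}$-almost surely and for every $\theta,\theta'\in A_i$, $|\Lambda_n(\theta;Y)-\Lambda_n(\theta';Y)|\le K_{n,i}\,d_{\mathcal T}(\theta,\theta')$. (3) Each $A_i$ can be covered by $M_{n,i}$ balls of radius $\delta_{n,i}$ such that, as $n\to\infty$, $K_{n,i}\delta_{n,i}\to 0$ in probability and $M_{n,i}a_{n,i}\to 0$. Then a maximizer $\hat\theta_n$ of $L_n(\theta;Y)$ over $\Theta$ exists $\mathsf P$-almost surely for every $n$, and $\hat\theta_n\to\theta^0$ in $\mathsf P$-probability as $n\to\infty$ for any sequence of such maximizers.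
   Context: For each $n$, $Y=(Y_1,\dots,Y_n)$ is a collection of random variables on a probability space $(\Omega,\mathcal F,\mathsf P)$ (triangular arrays are allowed: the components may depend on $n$). The parameter set $\Theta$ is a subset of a metric space $(\mathcal T,d_{\mathcal T})$; $B_\delta(t)=\{t'\in\mathcal T:d_{\mathcal T}(t,t')<\delta\}$, and $A^c$ denotes complement. For $\theta\in\Theta$, $f^n_\theta$ is a joint density for $Y$ against a dominating $\sigma$-finite product measure $\nu=\nu_n$, and may depend on $n$ in an arbitrary manner. The true parameter $\theta^0\in\Theta$ is the same for all $n$, meaning $\mathsf P(Y\in A)=\int_A f^n_{\theta^0}(y)\,\nu(dy)$ for all measurable $A$. Set $L_n(\theta;Y)=f^n_\theta(Y)/f^n_{\theta^0}(Y)$ and $\Lambda_n(\theta;Y)=\log L_n(\theta;Y)$. A subcollection $W=(W_1,\dots,W_m)$ of $Y$ is a collection of random variables with $\{W_1,\dots,W_m\}\subseteq\{Y_1,\dots,Y_n\}$, where $m=m(n)\to\infty$ as $n\to\infty$. Its joint density under $\theta$ (the corresponding marginal of $f^n_\theta$) is $g^m_\theta$, and $L_m(\theta;W)=g^m_\theta(W)/g^m_{\theta^0}(W)$. A subset $A\subseteq\Theta$ is identified by $W$ if $\sup_{\theta\in A}L_m(\theta;W)\to 0$ in $\mathsf P$-probability as $n\to\infty$. If $\sup_{\theta\in A}L_m(\theta;W)=O_{\mathsf P}(a_n)$ for a sequence of constants $\{a_n\}$, $a_n$ is called an identification rate. *)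

(* Defs.v *)
From HB Require Import structures.
From mathcomp Require Import all_boot all_order all_algebra.
From mathcomp Require Import all_classical all_reals all_analysis.

Set Implicit Arguments.
Unset Strict Implicit.
Unset Printing Implicit Defensive.

Import Order.TTheory GRing.Theory Num.Theory.
Import numFieldNormedType.Exports.

Local Open Scope classical_set_scope.
Local Open Scope ring_scope.

Section stochastic_order.
Context d (Omega : measurableType d) (R : realType) (P : probability Omega R).
Implicit Types X : nat -> Omega -> \bar R.

(* A supremum over an uncountable set of parameters, or a maximizer, need not
   be measurable, so events get their outer probability [mu_ext P]; it agrees
   with [P] on measurable sets ([measurable_mu_extE]). *)
Definition cvg_prob0 X : Prop :=
  forall e : R, 0 < e ->
    mu_ext P [set w | (e%:E <= `|X n w|)%E] @[n --> \oo] --> 0%E.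

Definition bigO_prob X (a : nat -> R) : Prop :=
  forall e : R, 0 < e -> exists C : R, \forall n \near \oo,
    (mu_ext P [set w | ((C * `|a n|)%:E < `|X n w|)%E] <= e%:E)%E.

End stochastic_order.

Section densities.
Context (R : realType).

Definition is_product_measure n
    (nu : 'I_n -> {sigma_finite_measure set R -> \bar R})
    (mu : {measure set (n.-tuple R) -> \bar R}) : Prop :=
  forall B : 'I_n -> set R, (forall i, measurable (B i)) ->
    mu [set y | forall i, B i (tnth y i)] = (\prod_(i < n) nu i (B i))%E.

Definition is_density n (mu : {measure set (n.-tuple R) -> \bar R})
    (h : n.-tuple R -> R) : Prop :=
  [/\ measurable_fun setT h, forall y, 0 <= h y &
      (\int[mu]_y (h y)%:E)%E = 1%E].

Definition subtuple n m (sub : 'I_m -> 'I_n) (y : n.-tuple R) : m.-tuple R :=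
  [tuple tnth y (sub j) | j < m].

Definition is_marginal_density n m (sub : 'I_m -> 'I_n)
    (mu : {measure set (n.-tuple R) -> \bar R}) (h : n.-tuple R -> R)
    (muW : {measure set (m.-tuple R) -> \bar R}) (g : m.-tuple R -> R) : Prop :=
  is_density muW g /\
  forall B : set (m.-tuple R), measurable B ->
    (\int[muW]_(w in B) (g w)%:E)%E =
    (\int[mu]_(y in subtuple sub @^-1` B) (h y)%:E)%E.

End densities.

Section likelihood.
Context (R : realType) (T U : Type).

(* The value 0 taken when [h theta0 y = 0] is immaterial: the observation has
   density [h theta0], so this is an event of probability zero that does not
   depend on [theta]. *)
Definition lik_ratio (h : T -> U -> R) (theta0 theta : T) (y : U) : R :=
  h theta y / h theta0 y.

(* [-oo] where the ratio vanishes. A difference of two such values, one of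
   them infinite, has absolute value [+oo] and is never bounded by a real. *)
Definition log_lik_ratio (h : T -> U -> R) (theta0 theta : T) (y : U) : \bar R :=
  lne (lik_ratio h theta0 theta y)%:E.

(* Supremum in [0, +oo], so that it is 0 when [A] is empty. *)
Definition sup_lik_ratio (h : T -> U -> R) (theta0 : T) (A : set T) (y : U) :
    \bar R :=
  maxe 0%E (ereal_sup [set (lik_ratio h theta0 theta y)%:E | theta in A]).

Definition is_maximizer (Theta : set T) (F : T -> R) (t : T) : Prop :=
  Theta t /\ forall t', Theta t' -> F t' <= F t.

End likelihood.

Definition sample d (Omega : measurableType d) (R : realType)
    (P : probability Omega R) n (Y : 'I_n -> {RV P >-> R}) (w : Omega) :
    n.-tuple R := [tuple Y i w | i < n].

Section identification.
Context d (Omega : measurableType d) (R : realType) (P : probability Omega R).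
Context (T : Type) (Theta : set T) (theta0 : T).

(* The subcollection W of the n-th sample is (Y_(sub n 0), ..., Y_(sub n (m n - 1))).
   Marginal densities are unique only almost everywhere, for each parameter
   separately; [g] is any choice of versions. *)
Definition identified_at_rate
    (Y : forall n, 'I_n -> {RV P >-> R})
    (nu : forall n, 'I_n -> {sigma_finite_measure set R -> \bar R})
    (mu : forall n, {measure set (n.-tuple R) -> \bar R})
    (f : forall n, T -> n.-tuple R -> R)
    (m : nat -> nat) (sub : forall n, 'I_(m n) -> 'I_n)
    (A : set T) (a : nat -> R) : Prop :=
  exists (muW : forall n, {measure set ((m n).-tuple R) -> \bar R})
         (g : forall n, T -> (m n).-tuple R -> R),
  [/\ forall n, (0 < n)%N ->
        is_product_measure (fun j => nu n (sub n j)) (muW n) /\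
        forall theta, Theta theta ->
          is_marginal_density (sub n) (mu n) (f n theta) (muW n) (g n theta),
      cvg_prob0 P (fun n w =>
        sup_lik_ratio (g n) theta0 A (sample (fun j => Y n (sub n j)) w)) &
      bigO_prob P (fun n w =>
        sup_lik_ratio (g n) theta0 A (sample (fun j => Y n (sub n j)) w)) a].

End identification.

(* Main.v *)
Require Import Defs.
From HB Require Import structures.
From mathcomp Require Import all_boot all_order all_algebra.
From mathcomp Require Import all_classical all_reals all_analysis.
From mathcomp Require Import measurable_realfun.
From mathcomp Require Import ring lra.

Set Implicit Arguments.
Unset Strict Implicit.
Unset Printing Implicit Defensive.

Import Order.TTheory GRing.Theory Num.Theory.
Import numFieldNormedType.Exports.

Local Open Scope classical_set_scope.
Local Open Scope ring_scope.

(** A maximizer has likelihood ratio at least that of [theta0], which is 1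
almost surely. If it is far from [theta0], it lies in one of finitely many
pieces [A], each identified by a subcollection [W] of [Y] at some rate [a n].
So it is enough that the event that [L_n] reaches 1 somewhere on [A] has outer
probability tending to 0.

Choose a point [theta_j] of [A] in each of the [M n] balls covering [A]. When
[`|K n * delta n| < 1/2], the Lipschitz bound makes [Lambda_n] vary by at most
1 within a ball, so [L_n >= 1] at some point of [A] forces
[L_n (theta_j) >= expR (- 1)] for some [j] ([lik_ratio_ge_expRN1]).

The conditional expectation of [L_n (theta_j; Y)] given [W] is at most
[L_m (theta_j; W)], so by Markov's inequality [L_n (theta_j; Y)] reaches
[expR (- 1)] with conditional probability at most
[expR 1 * L_m (theta_j; W)]. No conditioning is needed to use this: on the event
that [L_n (theta_j; Y) >= expR (- 1)] and [L_m (theta_j; W) <= b], the density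
of [theta0] is at most [expR 1] times that of [theta_j], so its probability is
at most [expR 1] times the integral of the density of [theta_j] over an event
determined by [W]. That integral is one of the marginal density of [theta_j],
which is at most [b] times the marginal density of [theta0]
([integral_low_marginal_high_joint]).

Now sum over [j] ([outer_prob_exceedance_le]) and take for [b] a constant times
[`|a n|]: the identification rate bounds the probability that [L_m] exceeds [b]
somewhere on [A], and the sum is a constant times [M n * `|a n|], which tends to
0 ([vanishing_exceedance]). Existence of a maximizer is the extreme value
theorem on the compact set [Theta]. *)

(** * Outer probability and vanishing sequences of events *)

Section outer_probability.
Context d (Omega : measurableType d) (R : realType) (P : probability Omega R).

Lemma mu_ext_bigcup_ord n (F : 'I_n -> set Omega) :
  (mu_ext P (\bigcup_i F i) <= \sum_(i < n) mu_ext P (F i))%E.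
Proof.
have -> : \bigcup_i F i = \big[setU/set0]_(i < n) F i.
  rewrite -bigcup_seq; apply: eq_bigcupl.
  by split=> i //= _; rewrite mem_index_enum.
elim/big_ind2 : _ => // [|A a B b Aa Bb].
  by rewrite outer_measure0.
by rewrite (le_trans (outer_measureU2 _ _ _))// leeD.
Qed.

Lemma mu_ext_negligible (N : set Omega) : P.-negligible N -> mu_ext P N = 0%E.
Proof.
move=> [B [mB B0 NB]]; apply/eqP; rewrite eq_le outer_measure_ge0 andbT.
by rewrite -B0 -(measurable_mu_extE P mB) le_outer_measure.
Qed.

Definition vanishing (E : nat -> set Omega) : Prop :=
  mu_ext P (E n) @[n --> \oo] --> 0%E.

Lemma vanishingP (E : nat -> set Omega) :
  vanishing E <->
  forall e : R, 0 < e -> \forall n \near \oo, (mu_ext P (E n) <= e%:E)%E.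
Proof.
split=> [E0 e e0|E0].
  have /fine_cvgP[Efin /cvgrPdist_le/(_ _ e0)] := E0.
  move: Efin; apply: filterS2 => n En; rewrite sub0r normrN => Ene.
  by rewrite -(fineK En) lee_fin (le_trans (ler_norm _)).
have Efin : \forall n \near \oo, mu_ext P (E n) \is a fin_num.
  move: (E0 1 ltr01); apply: filterS => n En.
  by rewrite ge0_fin_numE ?outer_measure_ge0// (le_lt_trans En)// ltry.
apply/fine_cvgP; split => //; apply/cvgrPdist_le => e e0.
move: Efin (E0 e e0); apply: filterS2 => n En Ene /=.
rewrite sub0r normrN ger0_norm ?fine_ge0 ?outer_measure_ge0//.
by rewrite -lee_fin fineK.
Qed.

Lemma vanishing_bigcup s (E : 'I_s -> nat -> set Omega) :
  (forall i, vanishing (E i)) -> vanishing (fun n => \bigcup_i E i n).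
Proof.
move=> E0; apply: (@squeeze_cvge _ _ _ _ (fun=> 0%E) _
    (fun n => \sum_(i < s) mu_ext P (E i n))%E).
- by apply: nearW => n; rewrite outer_measure_ge0 mu_ext_bigcup_ord.
- exact: cvg_cst.
- have : (\sum_(i < s) mu_ext P (E i n))%E @[n --> \oo] -->
      (\sum_(i < s) (0 : \bar R))%E.
    apply: cvg_nnesum => i _; last exact: E0.
    by apply: nearW => n; exact: outer_measure_ge0.
  by rewrite big1.
Qed.

End outer_probability.

(** * Change of density through a marginal *)

Section comparison.
Context (R : realType).

Lemma measurable_subtuple n m (sub : 'I_m -> 'I_n) :
  measurable_fun [set: n.-tuple R] (subtuple sub).
Proof.
apply/measurable_fun_tnthP => j.
rewrite (_ : _ \o _ = (@tnth _ R ^~ (sub j))); first exact: measurable_tnth.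
by apply/funext => y /=; rewrite tnth_mktuple.
Qed.

Lemma measurable_sample d (Omega : measurableType d) (P : probability Omega R)
    n (Y : 'I_n -> {RV P >-> R}) :
  measurable_fun [set: Omega] (sample Y).
Proof.
apply/measurable_fun_tnthP => j.
rewrite (_ : _ \o _ = Y j); first exact: measurable_funPT.
by apply/funext => y /=; rewrite tnth_mktuple.
Qed.

Lemma subtuple_sample d (Omega : measurableType d) (P : probability Omega R)
    n m (sub : 'I_m -> 'I_n) (Y : 'I_n -> {RV P >-> R}) (w : Omega) :
  sample (fun j => Y (sub j)) w = subtuple sub (sample Y w).
Proof. by apply: eq_from_tnth => j; rewrite !tnth_mktuple. Qed.

Context (n m : nat) (sub : 'I_m -> 'I_n).
Context (mu : {measure set (n.-tuple R) -> \bar R})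
        (muW : {measure set (m.-tuple R) -> \bar R}).

(** The inequalities are those of likelihood ratios with the denominators
cleared, so that the integral bound below holds without excluding the zeros of
[h0] and [g0]. *)
Definition low_marginal_high_joint (c b : R) (h0 h : n.-tuple R -> R)
    (g0 g : m.-tuple R -> R) : set (n.-tuple R) :=
  [set y | h0 y <= c * h y /\ g (subtuple sub y) <= b * g0 (subtuple sub y)].

Context (c b : R) (h0 h : n.-tuple R -> R) (g0 g : m.-tuple R -> R).
Hypotheses (c0 : 0 <= c) (b0 : 0 <= b).
Hypotheses (dh0 : is_density mu h0) (dh : is_density mu h).
Hypotheses (dg0 : is_density muW g0) (mg : is_marginal_density sub mu h muW g).

Let B := [set w | g w <= b * g0 w].

Let mB : measurable B.
Proof.
have [[gm _ _] _] := mg; have [g0m _ _] := dg0.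
rewrite -[B]setTI; apply: measurable_fun_le => //.
exact: measurable_funM.
Qed.

Lemma measurable_low_marginal_high_joint :
  measurable (low_marginal_high_joint c b h0 h g0 g).
Proof.
have [h0m _ _] := dh0; have [hm _ _] := dh.
rewrite (_ : low_marginal_high_joint _ _ _ _ _ _ =
  (setT `&` [set y | h0 y <= c * h y]) `&` (setT `&` subtuple sub @^-1` B)).
  apply: measurableI; last exact: measurable_subtuple.
  by apply: measurable_fun_le => //; exact: measurable_funM.
by rewrite !setTI.
Qed.

(** The form taken here by the conditional Markov inequality: replacing [h0] by
[c * h] costs a factor [c] and leaves an integral of [h] over an event about the
subtuple, which its marginal [g] computes; there [g] is at most [b * g0], and
[g0] has total mass 1. *)
Lemma integral_low_marginal_high_joint :
  (\int[mu]_(y in low_marginal_high_joint c b h0 h g0 g) (h0 y)%:E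
   <= (c * b)%:E)%E.
Proof.
have [h0m h0p _] := dh0; have [hm hp _] := dh.
have [g0m g0p g01] := dg0; have [[gm gp _] hg] := mg.
have mf k (D : set (k.-tuple R)) (u : k.-tuple R -> R) :
    measurable_fun setT u -> measurable_fun D (EFin \o u).
  by move=> mu'; apply: measurable_funTS; apply/measurable_EFinP.
have msubB : measurable (subtuple sub @^-1` B).
  by rewrite -[X in measurable X]setTI; exact: measurable_subtuple.
apply: (@le_trans _ _
  (\int[mu]_(y in low_marginal_high_joint c b h0 h g0 g) (c%:E * (h y)%:E))%E).
  apply: ge0_le_integral => //; last by move=> y []; rewrite -EFinM lee_fin.
  - exact: measurable_low_marginal_high_joint.
  - by move=> y _; rewrite lee_fin.
  - exact: mf.
  - by apply: (mf _ _ (fun y => c * h y)); exact: measurable_funM.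
rewrite ge0_integralZl_EFin//; last 3 first.
- exact: measurable_low_marginal_high_joint.
- by move=> y _; rewrite lee_fin.
- exact: mf.
rewrite EFinM lee_wpmul2l ?lee_fin//.
apply: (@le_trans _ _ (\int[mu]_(y in subtuple sub @^-1` B) (h y)%:E)%E).
  apply: ge0_subset_integral => //.
  - exact: measurable_low_marginal_high_joint.
  - exact: mf.
  - by move=> y _; rewrite lee_fin.
  - by move=> y [].
rewrite -hg//.
apply: (@le_trans _ _ (\int[muW]_(w in B) (b%:E * (g0 w)%:E))%E).
  apply: ge0_le_integral => //.
  - by move=> y _; rewrite lee_fin.
  - exact: mf.
  - by apply: (mf _ _ (fun y => b * g0 y)); exact: measurable_funM.
rewrite ge0_integralZl_EFin//; last 2 first.
- by move=> y _; rewrite lee_fin.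
- exact: mf.
rewrite -[leRHS]mule1 lee_wpmul2l ?lee_fin// -g01.
apply: ge0_subset_integral => //; first exact: mf.
by move=> y _; rewrite lee_fin.
Qed.

End comparison.

(** A density integrates to 0 over its own zero set. *)
Lemma ae_density_neq0 (R : realType) d (Omega : measurableType d)
    (P : probability Omega R) k (nu : {measure set (k.-tuple R) -> \bar R})
    (Z : Omega -> k.-tuple R) (h : k.-tuple R -> R) :
  measurable_fun setT Z ->
  (forall B, measurable B -> P (Z @^-1` B) = (\int[nu]_(z in B) (h z)%:E)%E) ->
  measurable_fun setT h ->
  {ae P, forall w, h (Z w) != 0}.
Proof.
move=> mZ lawZ mh.
have mh0 : measurable (h @^-1` [set 0]).
  by rewrite -[X in measurable X]setTI; exact: mh.
exists (Z @^-1` (h @^-1` [set 0])); split.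
- by rewrite -[X in measurable X]setTI; exact: mZ.
- by rewrite lawZ// integral0_eq// => w /= ->.
- by move=> w /= /negP; rewrite negbK => /eqP.
Qed.

(** * From a ball to its chosen point *)

Section lipschitz.
Context (R : realType) (T : metricType R) (U : Type).
Context (f : T -> U -> R) (theta0 : T) (y : U).
Let L t := lik_ratio f theta0 t y.
Let Lambda t := log_lik_ratio f theta0 t y.

(** A logarithm equal to [-oo] would make the left-hand side [+oo]: the
difference of two such values is infinite even at a single parameter. *)
Lemma lik_ratio_gt0_of_log (theta : T) :
  (`|Lambda theta - Lambda theta| <= 0)%E -> 0 < L theta.
Proof.
rewrite /Lambda /log_lik_ratio /= -/(L theta).
by case: ifPn => //; rewrite -ltNge.
Qed.

(** Two points of a ball of radius [delta] are at distance at most [2 * delta],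
so the logarithms differ by at most [2 * `|K * delta| < 1]. *)
Lemma lik_ratio_ge_expRN1 (A : set T) (K delta : R) (c theta theta1 : T) :
  (forall t t', A t -> A t' ->
    (`|Lambda t - Lambda t'| <= (K * mdist t t')%:E)%E) ->
  `|K * delta| < 2^-1 ->
  A theta -> A theta1 -> ball c delta theta -> ball c delta theta1 ->
  1 <= L theta -> expR (- 1) <= L theta1.
Proof.
move=> lip Kd At At1; rewrite !ballEmdist/= => ct ct1 Lt.
have Lgt0 t : A t -> 0 < L t.
  by move=> At'; apply: lik_ratio_gt0_of_log; have := lip _ _ At' At'; rewrite mdistxx mulr0.
have := lip _ _ At At1.
rewrite /Lambda /log_lik_ratio -!/(L _) !lne_EFin ?Lgt0// -EFinB lee_fin => lipL.
have dist : mdist theta theta1 <= 2 * delta.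
  rewrite (le_trans (metric_triangle _ c _))//.
  by rewrite [mdist theta c]metric_sym mulr_natl mulr2n lerD// ltW.
have delta0 : 0 <= delta by rewrite (le_trans (mdist_ge0 c theta))// ltW.
have KD : K * mdist theta theta1 <= 1.
  rewrite (le_trans (ler_norm _))// normrM (ger0_norm (mdist_ge0 _ _)).
  rewrite (le_trans (ler_wpM2l (normr_ge0 _) dist))//.
  move: Kd; rewrite normrM (ger0_norm delta0) => Kd.
  by rewrite mulrCA mulrC -ler_pdivlMr// div1r ltW.
rewrite -[L theta1]lnK ?posrE ?Lgt0// ler_expR.
have := ln_ge0 Lt; have := le_trans (ler_norm _) (le_trans lipL KD).
lra.
Qed.

End lipschitz.

(** * Reaching the level 1 on one piece *)

Section exceedance.
Context d (Omega : measurableType d) (R : realType) (P : probability Omega R).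
Context (T : metricType R) (Theta A : set T) (theta0 : T).
Context (n m : nat) (sub : 'I_m -> 'I_n) (Y : 'I_n -> {RV P >-> R}).
Context (mu : {measure set (n.-tuple R) -> \bar R})
        (muW : {measure set (m.-tuple R) -> \bar R}).
Context (f : T -> n.-tuple R -> R) (g : T -> m.-tuple R -> R).
Context (K : Omega -> R) (delta : R) (M : nat) (c : 'I_M -> T).
Hypothesis Theta_theta0 : Theta theta0.
Hypothesis ATheta : A `<=` Theta.
Hypothesis f_density : forall theta, Theta theta -> is_density mu (f theta).
Hypothesis Y_law : forall B, measurable B ->
  P (sample Y @^-1` B) = (\int[mu]_(y in B) (f theta0 y)%:E)%E.
Hypothesis marginal : forall theta, Theta theta ->
  is_marginal_density sub mu (f theta) muW (g theta).
Hypothesis lip : {ae P, forall w, forall theta theta',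
  A theta -> A theta' ->
  (`| log_lik_ratio f theta0 theta (sample Y w)
      - log_lik_ratio f theta0 theta' (sample Y w) |
   <= (K w * mdist theta theta')%:E)%E}.
Hypothesis cover : A `<=` \bigcup_j ball (c j) delta.

Lemma ae_marginal_density_neq0 :
  {ae P, forall w, g theta0 (sample (fun j => Y (sub j)) w) != 0}.
Proof.
have [[gm _ _] fg] := marginal Theta_theta0.
apply: (@ae_density_neq0 _ _ _ P _ muW) => //; first exact: measurable_sample.
move=> B mB.
rewrite (_ : _ @^-1` B = sample Y @^-1` (subtuple sub @^-1` B)).
  rewrite Y_law ?fg//.
  by rewrite -[X in measurable X]setTI; exact: measurable_subtuple.
by apply/seteqP; split=> w /=; rewrite (subtuple_sample sub Y).
Qed.

(** Off a null set, reaching 1 on [A] means that the Lipschitz bound is too weak,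
or that the likelihood ratio of the subcollection exceeds [b] somewhere on [A],
or that one of the [M] chosen points reaches [exp (- 1)] although its ratio on
the subcollection is at most [b]; the last event has probability at most
[expR 1 * b] for each point. *)
Lemma outer_prob_exceedance_le (b : R) : 0 <= b ->
  (mu_ext P [set w | exists2 theta, A theta &
       (1 <= lik_ratio f theta0 theta (sample Y w))%R]
   <= mu_ext P [set w | (2^-1)%:E <= `|(K w * delta)%:E|]
    + mu_ext P [set w |
        b%:E < `|sup_lik_ratio g theta0 A (sample (fun j => Y (sub j)) w)|]
    + (M%:R * (expR 1 * b))%:E)%E.
Proof.
move=> b0.
set E := [set w | _]; set E1 := [set w | _]; set E2 := [set w | _].
have [A0|/set0P[thetaA AthetaA]] := eqVneq A set0.
  rewrite (_ : E = set0); last by apply/seteqP; split=> // w []; rewrite A0.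
  rewrite outer_measure0 adde_ge0 ?adde_ge0 ?outer_measure_ge0//.
  by rewrite lee_fin !mulr_ge0// expR_ge0.
(* The centres need not lie in [A], where alone the hypotheses apply; a ball
   that misses [A] gets an arbitrary point of [A]. *)
have /choice[net netP] : forall j, exists t, A t /\
    ((exists2 t', A t' & ball (c j) delta t') -> ball (c j) delta t).
  move=> j.
  have [[t At ct]|nt] := pselect (exists2 t, A t & ball (c j) delta t).
    by exists t.
  by exists thetaA.
pose S j := sample Y @^-1` low_marginal_high_joint sub (expR 1) b
  (f theta0) (f (net j)) (g theta0) (g (net j)).
have f0 := f_density Theta_theta0.
have [dg0 _] := marginal Theta_theta0.
have g0p : forall z, 0 <= g theta0 z by case: dg0.
have fnet j : is_density mu (f (net j)).
  by apply: f_density; apply: ATheta; case: (netP j).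
have gnet j : is_marginal_density sub mu (f (net j)) muW (g (net j)).
  by apply: marginal; apply: ATheta; case: (netP j).
have S_le j : (mu_ext P (S j) <= (expR 1 * b)%:E)%E.
  have mS := measurable_low_marginal_high_joint (expR 1) b f0 (fnet j) dg0 (gnet j).
  rewrite measurable_mu_extE; last first.
    by rewrite -[X in measurable X]setTI; exact: measurable_sample.
  rewrite [leLHS]Y_law//.
  exact: (integral_low_marginal_high_joint _ b0 f0 (fnet j) dg0 (gnet j)).
have f0_neq0 : {ae P, forall w, f theta0 (sample Y w) != 0}.
  by apply: (ae_density_neq0 _ Y_law) => //; [exact: measurable_sample|case: f0].
pose G := [set w | [/\ f theta0 (sample Y w) != 0,
  g theta0 (sample (fun j => Y (sub j)) w) != 0 &
  forall theta theta', A theta -> A theta' ->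
  (`| log_lik_ratio f theta0 theta (sample Y w)
      - log_lik_ratio f theta0 theta' (sample Y w) |
   <= (K w * mdist theta theta')%:E)%E]].
have aeG : P.-negligible (~` G).
  have : {ae P, forall w, G w}.
    move: ae_marginal_density_neq0 lip f0_neq0.
    by apply: filterS3 => w.
  by [].
have EsubU : E `<=` ((~` G `|` E1) `|` E2) `|` \bigcup_j S j.
  move=> w [theta Atheta Ltheta].
  have [Gw|nGw] := pselect (G w); last by left; left; left.
  have [E1w|nE1w] := pselect (E1 w); first by left; left; right.
  have [E2w|nE2w] := pselect (E2 w); first by left; right.
  right; case: Gw => f0w g0w lipw.
  have [j _ cjt] := cover Atheta.
  have [Aj /(_ (ex_intro2 _ _ theta Atheta cjt)) cj] := netP j.
  exists j => //; split.
    have KD : `|K w * delta| < 2^-1.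
      by rewrite ltNge; apply/negP => h; apply: nE1w; rewrite /E1/= lee_fin.
    have := lik_ratio_ge_expRN1 lipw KD Atheta Aj cjt cj Ltheta.
    rewrite /lik_ratio ler_pdivlMr; last first.
      by rewrite lt_neqAle eq_sym f0w; case: f0 => _ ->.
    by rewrite expRN mulrC ler_pdivrMr ?expR_gt0// mulrC.
  have : (sup_lik_ratio g theta0 A (sample (fun j => Y (sub j)) w) <= b%:E)%E.
    rewrite leNgt; apply/negP => h; apply: nE2w; rewrite /E2/=.
    by rewrite gee0_abs// /sup_lik_ratio le_max lexx.
  rewrite /sup_lik_ratio ge_max => /andP[_].
  set L := (X in ereal_sup X).
  have Lj : L (lik_ratio g theta0 (net j)
      (sample (fun j => Y (sub j)) w))%:E by exists (net j).
  move=> /(le_trans (ereal_sup_ubound Lj)).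
  rewrite lee_fin /lik_ratio (subtuple_sample sub Y) ler_pdivrMr//.
  by rewrite lt_neqAle eq_sym g0p andbT -(subtuple_sample sub Y).
rewrite (le_trans (le_outer_measure _ _ _ EsubU))//.
rewrite (le_trans (outer_measureU2 _ _ _))//; apply: leeD.
  rewrite (le_trans (outer_measureU2 _ _ _))// leeD2r//.
  by rewrite (le_trans (outer_measureU2 _ _ _))//= (mu_ext_negligible aeG)// add0e.
rewrite (le_trans (mu_ext_bigcup_ord _ _))//.
rewrite (le_trans (lee_sum _ (fun j _ => S_le j)))//.
by rewrite sumEFin lee_fin sumr_const card_ord mulr_natl.
Qed.

End exceedance.

(** Taking [b] equal to a constant times [`|a n|], where the rate provides the
constant for tolerance [e / 3], bounds each of the three terms of [outer_prob_exceedance_le] by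
[e / 3] for large [n]. *)
Lemma vanishing_exceedance d (Omega : measurableType d) (R : realType)
    (P : probability Omega R) (T : metricType R) (Theta A : set T) (theta0 : T)
    (Y : forall n : nat, 'I_n -> {RV P >-> R})
    (nu : forall n : nat, 'I_n -> {sigma_finite_measure set R -> \bar R})
    (mu : forall n : nat, {measure set (n.-tuple R) -> \bar R})
    (f : forall n : nat, T -> n.-tuple R -> R)
    (m : nat -> nat) (sub : forall n, 'I_(m n) -> 'I_n)
    (a : nat -> R) (K : nat -> Omega -> R) (M : nat -> nat)
    (delta : nat -> R) :
  Theta theta0 -> A `<=` Theta ->
  (forall n theta, (0 < n)%N -> Theta theta ->
    is_density (mu n) (f n theta)) ->
  (forall n (B : set (n.-tuple R)), (0 < n)%N -> measurable B ->
    P (sample (Y n) @^-1` B) = (\int[mu n]_(y in B) (f n theta0 y)%:E)%E) ->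
  identified_at_rate Theta theta0 Y nu mu f sub A a ->
  (forall n, (0 < n)%N -> {ae P, forall w, forall theta theta',
    A theta -> A theta' ->
    (`| log_lik_ratio (f n) theta0 theta (sample (Y n) w)
        - log_lik_ratio (f n) theta0 theta' (sample (Y n) w) |
     <= (K n w * mdist theta theta')%:E)%E}) ->
  (forall n, (0 < n)%N -> exists c : 'I_(M n) -> T,
    A `<=` \bigcup_j ball (c j) (delta n)) ->
  cvg_prob0 P (fun n w => (K n w * delta n)%:E) ->
  (M n)%:R * a n @[n --> \oo] --> 0 ->
  vanishing P (fun n => [set w | exists2 theta, A theta &
    1 <= lik_ratio (f n) theta0 theta (sample (Y n) w)]).
Proof.
move=> Theta0 ATheta fd Ylaw [muW [g [marg _ bigO]]] lip cover Kd0 Ma0.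
apply/vanishingP => e e0.
have e30 : 0 < e / 3 by rewrite divr_gt0.
have [C Csup] := bigO _ e30.
(* The rate may provide a negative constant, but the level [b] must be
   nonnegative. *)
pose C' := Num.max C 0.
have C'0 : 0 <= C' by rewrite le_max lexx orbT.
(* [C' + 1] rather than [C'], which may vanish and serves as a divisor. *)
have eC0 : 0 < expR 1 * (C' + 1) :> R by rewrite mulr_gt0 ?expR_gt0// ltr_wpDl.
have half0 : 0 < 2^-1 :> R by [].
have /vanishingP/(_ _ e30) Kd := Kd0 _ half0.
have /cvgrPdist_le/(_ _ (divr_gt0 e30 eC0)) Ma := Ma0.
near=> n.
have n0 : (0 < n)%N by near: n; exact: nbhs_infty_gt.
have [c Ac] := cover _ n0.
have [_ margn] := marg _ n0.
have b0 : 0 <= C' * `|a n| by rewrite mulr_ge0.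
apply: le_trans (outer_prob_exceedance_le Theta0 ATheta (fun t => fd n t n0)
  (fun B => Ylaw n B n0) margn (lip _ n0) Ac b0) _.
have -> : e = e / 3 + e / 3 + e / 3 by lra.
rewrite !EFinD; apply: leeD; [apply: leeD|].
- by near: n.
- apply: (@le_trans _ _ (mu_ext P [set w | ((C * `|a n|)%:E <
    `|sup_lik_ratio (g n) theta0 A (sample (fun j => Y n (sub n j)) w)|)%E])).
    apply: le_outer_measure => w /=; apply: le_lt_trans.
    by rewrite lee_fin ler_wpM2r// le_max lexx.
  by near: n.
rewrite lee_fin.
have : `|0 - (M n)%:R * a n| <= e / 3 / (expR 1 * (C' + 1)) by near: n.
rewrite sub0r normrN normrM normr_nat ler_pdivlMr//; apply: le_trans.
rewrite [leRHS]mulrC [leLHS](_ : _ = expR 1 * C' * ((M n)%:R * `|a n|)); last by ring.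
by rewrite ler_wpM2r ?mulr_ge0// ler_wpM2l ?expR_ge0// lerDl.
Unshelve. all: by end_near. Qed.

(** * Consistency *)

Unset Implicit Arguments.

Theorem theorem2p3 (R : realType) (d : measure_display)
  (Omega : measurableType d) (P : probability Omega R)
  (T : metricType R) (Theta : set T) (theta0 : T)
  (Y : forall n : nat, 'I_n -> {RV P >-> R})
  (nu : forall n : nat, 'I_n -> {sigma_finite_measure set R -> \bar R})
  (mu : forall n : nat, {measure set (n.-tuple R) -> \bar R})
  (f : forall n : nat, T -> n.-tuple R -> R)
  (Theta_theta0 : Theta theta0)
  (mu_product : forall n, (0 < n)%N -> is_product_measure (nu n) (mu n))
  (f_density : forall n theta, (0 < n)%N -> Theta theta ->
    is_density (mu n) (f n theta))
  (Y_law : forall n (B : set (n.-tuple R)), (0 < n)%N -> measurable B ->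
    P (sample (Y n) @^-1` B) = (\int[mu n]_(y in B) (f n theta0 y)%:E)%E)
  (Theta_compact : compact Theta)
  (L_continuous : forall n, (0 < n)%N ->
    {ae P, forall w, {within Theta, continuous
      (fun theta => lik_ratio (f n) theta0 theta (sample (Y n) w))}})
  (subsets : exists2 eps0 : R, 0 < eps0 &
    forall eps : R, 0 < eps -> eps < eps0 ->
    exists (s : nat) (A : 'I_s -> set T)
      (m : 'I_s -> nat -> nat) (sub : forall i n, 'I_(m i n) -> 'I_n)
      (a : 'I_s -> nat -> R) (K : 'I_s -> nat -> {RV P >-> R})
      (M : 'I_s -> nat -> nat) (delta : 'I_s -> nat -> R),
      [/\ forall i, A i `<=` Theta,
          Theta `&` ~` ball theta0 eps `<=` \bigcup_i A i,
          forall i, (forall n, injective (sub i n)) /\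
            m i n @[n --> \oo] --> \oo &
      [/\ (* (1) *)
          forall i,
            identified_at_rate Theta theta0 Y nu mu f (sub i) (A i) (a i),
          (* (2) *)
          forall i n, (0 < n)%N -> {ae P, forall w, forall theta theta',
            A i theta -> A i theta' ->
            (`| log_lik_ratio (f n) theta0 theta (sample (Y n) w)
                - log_lik_ratio (f n) theta0 theta' (sample (Y n) w) |
             <= (K i n w * mdist theta theta')%:E)%E} &
          (* (3) *)
          forall i,
          [/\ forall n, (0 < n)%N -> 0 < delta i n /\
                exists c : 'I_(M i n) -> T,
                  A i `<=` \bigcup_j ball (c j) (delta i n),
              cvg_prob0 P (fun n w => (K i n w * delta i n)%:E) &
              (M i n)%:R * a i n @[n --> \oo] --> 0]]]) :
  (forall n, (0 < n)%N -> {ae P, forall w, exists theta,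
    is_maximizer Theta
      (fun t => lik_ratio (f n) theta0 t (sample (Y n) w)) theta}) /\
  (forall thetahat : nat -> Omega -> T,
    (forall n, (0 < n)%N -> {ae P, forall w,
      is_maximizer Theta
        (fun t => lik_ratio (f n) theta0 t (sample (Y n) w))
        (thetahat n w)}) ->
    cvg_prob0 P (fun n w => (mdist (thetahat n w) theta0)%:E)).
Proof.
split=> [n n0|thetahat thetahat_max e e0].
  move: (L_continuous n n0); apply: filterS => w Lcont.
  have [|t /set_mem Tt tmax] := compact_EVT_max _ Theta_compact Lcont.
    by exists theta0.
  by exists t; split=> // t' Tt'; exact/tmax/mem_set.
have [eps0 eps00 pieces] := subsets.
(* The distance [e] need not be small, whereas covers are provided only for
   radii below [eps0]. *)
have eps_gt0 : 0 < Num.min e (eps0 / 2) by rewrite lt_min e0 divr_gt0.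
have eps_lt : Num.min e (eps0 / 2) < eps0.
  by rewrite gt_min orbC ltr_pdivrMr// ltr_pMr// ltr1n.
have [s [A [m [sub [a [K [M [delta]]]]]]]] := pieces _ eps_gt0 eps_lt.
move=> [ATheta Acover _ [ident lip net]].
have E0 : vanishing P (fun n => \bigcup_i [set w | exists2 theta, A i theta &
    1 <= lik_ratio (f n) theta0 theta (sample (Y n) w)]).
  apply: vanishing_bigcup => i; have [dc Kd Ma] := net i.
  apply: (vanishing_exceedance Theta_theta0 (ATheta i) f_density Y_law (ident i)
    (lip i) _ Kd Ma).
  by move=> n /dc[].
apply/vanishingP => r r0; have /vanishingP/(_ _ r0) := E0.
move: (nbhs_infty_gt 0); apply: filterS2 => n n0; apply: le_trans.
have [f0m _ _] := f_density n theta0 n0 Theta_theta0.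
have f0_neq0 : {ae P, forall w, f n theta0 (sample (Y n) w) != 0}.
  apply: (ae_density_neq0 _ _ f0m); first exact: measurable_sample.
  by move=> B; exact: Y_law.
pose G := [set w | f n theta0 (sample (Y n) w) != 0 /\ is_maximizer Theta
  (fun t => lik_ratio (f n) theta0 t (sample (Y n) w)) (thetahat n w)].
have aeG : P.-negligible (~` G).
  have : {ae P, forall w, G w} by move: f0_neq0 (thetahat_max n n0); exact: filterS2.
  by [].
set U := \bigcup_i _.
rewrite -[leRHS]add0e -(mu_ext_negligible aeG).
apply: le_trans (outer_measureU2 _ _ _); apply: le_outer_measure => w /= far.
have [[f0w [Tt tmax]]|nG] := pselect (G w); [right|by left].
have [|i _ Ai] := Acover (thetahat n w).
  split=> //; rewrite ballEmdist/= => near_w.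
  move: far; rewrite lee_fin ger0_norm ?mdist_ge0// metric_sym leNgt.
  by rewrite (lt_le_trans near_w)// ge_min lexx.
exists i => //; exists (thetahat n w) => //.
by have := tmax _ Theta_theta0; rewrite {1}/lik_ratio divff.
Qed.
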